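(* Any function of the class of permutation graphs is polynomially $\chi$-bounded.
   Context: All graphs are finite and simple; a class of graphs is a set of graphs closed under isomorphism. A permutation graph is a graph that is both a comparability graph (the graph of comparable pairs of some partial order on its vertex set) and the complement of a comparability graph. For a graph $G$ and distinct vertices $u,w$, $G(u,w)=1$ if they are adjacent and $0$ otherwise. If $G,H_1,\dots,H_k$ are graphs on the same vertex set $V$, $G$ is a (boolean) function of $H_1,\dots,H_k$ if there is a boolean function $f:\{0,1\}^k\to\{0,1\}$ with $G(a,b)=f(H_1(a,b),\dots,H_k(a,b))$ for all distinct $a,b\in V$. A class $\mathcal{Y}$ is a function of $\mathcal{X}$ if for some $k\in\mathbb{N}$ every $G\in\mathcal{Y}$ is a function of at most $k$ graphs from $\mathcal{X}$ (on the vertex set of $G$). A class is polynomially $\chi$-bounded if there is a polynomial $g$ with $\chi(H)\le g(\omega(H))$ for every induced subgraph $H$ of every graph in the class ($\chi$ = chromatic number, $\omega$ = clique number). *)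

(* Defs.v *)
From HB Require Import structures.
From mathcomp Require Import all_boot all_order all_algebra.

Set Implicit Arguments.
Unset Strict Implicit.
Unset Printing Implicit Defensive.

Record sgraph (V : finType) := SGraph {
  adj :> rel V;
  adj_sym : symmetric adj;
  adj_irr : irreflexive adj }.

Definition graph_iso (V W : finType) (G : sgraph V) (H : sgraph W) : Prop :=
  exists2 h : V -> W, bijective h & forall x y, H (h x) (h y) = G x y.

Record graph_class := GraphClass {
  in_class :> forall V : finType, sgraph V -> Prop;
  class_iso : forall (V W : finType) (G : sgraph V) (H : sgraph W),
    graph_iso G H -> in_class G -> in_class H }.

Section Complement.
Variables (V : finType) (G : sgraph V).

Definition compl_adj : rel V := fun x y => (x != y) && ~~ G x y.

Lemma compl_adj_sym : symmetric compl_adj.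
Proof. by move=> x y; rewrite /compl_adj eq_sym adj_sym. Qed.

Lemma compl_adj_irr : irreflexive compl_adj.
Proof. by move=> x; rewrite /compl_adj eqxx. Qed.

Definition compl : sgraph V := SGraph compl_adj_sym compl_adj_irr.

End Complement.

Section Induced.
Variables (V : finType) (G : sgraph V) (S : {set V}).

Definition induced_adj : rel {x : V | x \in S} := fun x y => G (val x) (val y).

Lemma induced_adj_sym : symmetric induced_adj.
Proof. by move=> x y; rewrite /induced_adj adj_sym. Qed.

Lemma induced_adj_irr : irreflexive induced_adj.
Proof. by move=> x; rewrite /induced_adj adj_irr. Qed.

Definition induced : sgraph {x : V | x \in S} :=
  SGraph induced_adj_sym induced_adj_irr.

End Induced.

Definition comparability_graph (V : finType) (G : sgraph V) : Prop :=
  exists le : rel V,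
    [/\ reflexive le, antisymmetric le, transitive le
      & forall x y, G x y = (x != y) && (le x y || le y x)].

Definition permutation_graph (V : finType) (G : sgraph V) : Prop :=
  comparability_graph G /\
  exists2 H : sgraph V, comparability_graph H & forall x y, G x y = compl H x y.

Lemma comparability_graph_iso (V W : finType) (G : sgraph V) (H : sgraph W) :
  graph_iso G H -> comparability_graph G -> comparability_graph H.
Proof.
case=> h [h' hK h'K] hE [le [le_refl le_anti le_trans GE]].
exists (fun x y => le (h' x) (h' y)); split.
- by move=> x; apply: le_refl.
- by move=> x y /le_anti /(can_inj h'K).
- by move=> y x z; apply: le_trans.
- move=> x y; rewrite -{1}(h'K x) -{1}(h'K y) hE GE.
  by rewrite (inj_eq (can_inj h'K)).
Qed.

Lemma permutation_graph_iso (V W : finType) (G : sgraph V) (H : sgraph W) :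
  graph_iso G H -> permutation_graph G -> permutation_graph H.
Proof.
move=> GH [cG [K cK GE]]; split; first exact: comparability_graph_iso GH cG.
case: GH => h [h' hK h'K] hE.
have Ks : symmetric (fun x y => K (h' x) (h' y)).
  by move=> x y; rewrite adj_sym.
have Ki : irreflexive (fun x y => K (h' x) (h' y)).
  by move=> x; rewrite adj_irr.
exists (SGraph Ks Ki).
  apply: comparability_graph_iso cK; exists h; first by exists h'.
  by move=> x y /=; rewrite !hK.
move=> x y; rewrite -{1}(h'K x) -{1}(h'K y) hE GE /= /compl_adj /=.
by rewrite (inj_eq (can_inj h'K)).
Qed.

Definition permutation_graphs : graph_class := GraphClass permutation_graph_iso.

Definition graph_function_of (V : finType) (G : sgraph V) (k : nat)
    (H : 'I_k -> sgraph V) : Prop :=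
  exists f : k.-tuple bool -> bool,
    forall a b : V, a != b -> G a b = f [tuple H i a b | i < k].

Definition class_function_of (Y X : graph_class) : Prop :=
  exists k : nat, forall (V : finType) (G : sgraph V), Y V G ->
    exists (m : nat) (H : 'I_m -> sgraph V),
      [/\ m <= k, forall i, X V (H i) & graph_function_of G H].

Definition clique (V : finType) (G : sgraph V) (A : {set V}) : bool :=
  [forall x in A, forall y in A, (x != y) ==> G x y].

Definition clique_number (V : finType) (G : sgraph V) : nat :=
  \max_(A : {set V} | clique G A) #|A|.

Definition colorable (V : finType) (G : sgraph V) (k : nat) : bool :=
  [exists c : {ffun V -> 'I_k}, forall x, forall y, G x y ==> (c x != c y)].

Lemma colorable_ex (V : finType) (G : sgraph V) : exists k, colorable G k.
Proof.
exists #|V|; apply/existsP; exists [ffun x => enum_rank x].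
apply/forallP=> x; apply/forallP=> y; apply/implyP=> Gxy.
rewrite !ffunE (inj_eq enum_rank_inj); apply: contraTneq Gxy => ->.
by rewrite adj_irr.
Qed.

Definition chromatic_number (V : finType) (G : sgraph V) : nat :=
  ex_minn (colorable_ex G).

Definition polynomially_chi_bounded (Y : graph_class) : Prop :=
  exists g : {poly int}, forall (V : finType) (G : sgraph V), Y V G ->
    forall S : {set V},
      ((chromatic_number (induced G S))%:Z
         <= g.[(clique_number (induced G S))%:Z])%R.

(* Main.v *)
Require Import Defs.
From mathcomp Require Import all_boot all_order all_algebra.

(** If [G] is a boolean function of permutation graphs [H_1, ..., H_m], fix
    partial orders whose comparability graphs are [H_i] and its complement.
    Prescribing for every [i] which of the two orders relates [x] and [y], and
    in which direction, gives an intersection of partial orders, hence again a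
    partial order; these [4^m] orders cover all pairs of vertices, and since
    the prescription determines every [H_i x y], each of them lies inside [G]
    or inside its complement.  So the edges of [G] are covered by [4^m]
    comparability graphs contained in [G], each of which can be coloured with
    [ω(G)] colours by heights of chains.  The product colouring gives
    [χ(G) <= ω(G)^(4^m)], and everything restricts to induced subgraphs. *)

Lemma chromatic_number_le_card (V D : finType) (G : sgraph V) (c : V -> D) :
  (forall x y, G x y -> c x != c y) -> chromatic_number G <= #|D|.
Proof.
move=> c_proper; rewrite /chromatic_number; case: ex_minnP => n _; apply.
apply/existsP; exists [ffun x => enum_rank (c x)].
apply/forallP=> x; apply/forallP=> y; apply/implyP=> /c_proper.
by rewrite !ffunE (inj_eq enum_rank_inj).
Qed.

Section Height.
Variables (V : finType) (G : sgraph V) (R : rel V).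
Hypotheses (R_trans : transitive R) (RG : subrel R G).

(** [A] need only be a clique of [G], not a chain of [R], so that heights compare with ω(G)
    directly. *)
Definition clique_below (x : V) (A : {set V}) : bool :=
  clique G A && [forall y in A, R y x].

Definition height (x : V) : nat := \max_(A | clique_below x A) #|A|.

Lemma clique_belowU1 (x : V) (A : {set V}) :
  clique_below x A -> clique G (x |: A) && (#|x |: A| == #|A|.+1).
Proof.
case/andP=> /forall_inP Acl /forall_inP Ax.
rewrite cardsU1 (contraFN (Ax x)); last first.
  by apply: contraFF (adj_irr G x) => /RG.
rewrite eqxx andbT.
apply/forall_inP=> y y_in; apply/forall_inP=> z z_in; apply/implyP.
move: y_in z_in; rewrite !in_setU1.
case/predU1P=> [->|Ay]; case/predU1P=> [->|Az].
- by rewrite eqxx.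
- by move=> _; rewrite adj_sym RG ?Ax.
- by move=> _; rewrite RG ?Ax.
- by move=> yz; move: (Acl _ Ay) => /forall_inP /(_ _ Az) /implyP /(_ yz).
Qed.

Lemma height_witness (x : V) :
  exists2 A : {set V}, clique_below x A & height x = #|A|.
Proof.
have below0 : clique_below x set0.
  by apply/andP; split; apply/forall_inP=> y; rewrite inE.
by have [|A] := eq_bigmax_cond (fun A : {set V} => #|A|)
  (A := clique_below x); [apply/card_gt0P; exists set0 | exists A].
Qed.

Lemma height_lt_clique_number (x : V) : height x < clique_number G.
Proof.
have [A /clique_belowU1 /andP[clA /eqP cardA] ->] := height_witness x.
by rewrite -cardA; apply: leq_bigmax_cond.
Qed.

(** A largest clique below [x], enlarged by [x] itself, lies below [y] by transitivity. *)
Lemma height_lt (x y : V) : R x y -> height x < height y.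
Proof.
move=> Rxy; have [A Ax ->] := height_witness x.
have /andP[clA /eqP cardA] := clique_belowU1 _ _ Ax.
rewrite -cardA; apply: leq_bigmax_cond; rewrite /clique_below clA.
apply/forall_inP=> z /setU1P[-> //|Az].
by apply: R_trans Rxy; case/andP: Ax => _ /forall_inP; apply.
Qed.

End Height.

Lemma chromatic_number_cover (V I : finType) (G : sgraph V) (R : I -> rel V) :
  (forall i, transitive (R i)) -> (forall i, subrel (R i) G) ->
  (forall x y, G x y -> exists i, R i x y || R i y x) ->
  chromatic_number G <= clique_number G ^ #|I|.
Proof.
move=> R_trans RG cover.
pose c x := [ffun i => Ordinal (height_lt_clique_number _ _ _ (RG i) x)].
apply: leq_trans (chromatic_number_le_card _ _ _ c _) _; last first.
  by rewrite card_ffun card_ord.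
move=> x y /cover[i Rxy]; apply/eqP=> /ffunP/(_ i); rewrite !ffunE.
case=> eq_height; case/orP: Rxy => /(height_lt _ _ _ (R_trans i) (RG i));
  by rewrite eq_height ltnn.
Qed.

Lemma permutation_graph_orders (V : finType) (H : sgraph V) :
  permutation_graph H ->
  exists2 L : bool -> rel V, forall b, transitive (L b)
    & forall b x y, x != y -> (H x y == b) = L b x y || L b y x.
Proof.
case=> [[le1 [_ _ tr1 HE1]]] [K [le0 [_ _ tr0 KE]] HE0].
exists (fun b => if b then le1 else le0); first by case.
case=> x y xy; first by rewrite eqb_id HE1 xy.
by rewrite eqbF_neg HE0 /= /compl_adj xy KE xy negbK.
Qed.

Section OrderCover.
Variables (V : finType) (G : sgraph V) (m : nat).
Variables (H : 'I_m -> sgraph V) (f : m.-tuple bool -> bool).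
Variable L : 'I_m -> bool -> rel V.
Hypothesis GE : forall x y, x != y -> G x y = f [tuple H i x y | i < m].
Hypothesis L_trans : forall i b, transitive (L i b).
Hypothesis LE :
  forall i b x y, x != y -> (H i x y == b) = L i b x y || L i b y x.

(* For [p i = (b, s)], [b] prescribes the value of [H i x y] and [s] the
   direction in the corresponding order.  The comparison of ranks makes the
   relation irreflexive even when [m = 0]. *)
Definition pattern_order (p : {ffun 'I_m -> bool * bool}) : rel V :=
  fun x y => [&& enum_rank x < enum_rank y, f [tuple (p i).1 | i < m]
    & [forall i, if (p i).2 then L i (p i).1 x y else L i (p i).1 y x]].

Lemma pattern_order_trans p : transitive (pattern_order p).
Proof.
move=> y x z /and3P[xy fp /forallP Lxy] /and3P[yz _ /forallP Lyz].
apply/and3P; split=> //; first exact: ltn_trans yz.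
apply/forallP=> i; move: (Lxy i) (Lyz i); case: ifP => _ Lx Ly.
  exact: L_trans Ly.
exact: L_trans Lx.
Qed.

Lemma pattern_order_sub p : subrel (pattern_order p) G.
Proof.
move=> x y /and3P[xy fp /forallP Lxy].
have neq_xy : x != y by apply: contraTneq xy => ->; rewrite ltnn.
rewrite GE //; congr (is_true (f _)): fp; apply: eq_mktuple => i.
(* [L i b] relating [x] and [y] in either direction forces [H i x y = b]. *)
apply/esym/eqP; rewrite LE //.
by have := Lxy i; case: ifP => _ ->; rewrite ?orbT.
Qed.

Lemma pattern_order_cover x y :
  G x y -> exists p, pattern_order p x y || pattern_order p y x.
Proof.
wlog xy : x y / enum_rank x < enum_rank y => [wlog_lt|] Gxy.
  have [/wlog_lt|/wlog_lt|/val_inj/enum_rank_inj eq_xy] :=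
    ltngtP (enum_rank x) (enum_rank y).
  - exact.
  - by rewrite adj_sym => /(_ Gxy)[p]; rewrite orbC; exists p.
  - by rewrite eq_xy adj_irr in Gxy.
have neq_xy : x != y by apply: contraTneq xy => ->; rewrite ltnn.
(* The pattern is read off the pair; where the direction bit is [false], [LE] leaves only the order
   relating [y] to [x]. *)
exists [ffun i => (H i x y, L i (H i x y) x y)]; apply/orP; left.
apply/and3P; split=> //.
  move: Gxy; rewrite GE //; congr (is_true (f _)).
  by apply: eq_mktuple => i; rewrite ffunE.
apply/forallP=> i; rewrite ffunE /=.
have := LE i (H i x y) _ _ neq_xy; rewrite eqxx.
by case: ifP => // ->.
Qed.

(** The orders are restricted to [S], rather than the graphs [H i]. *)
Lemma chromatic_number_induced_le (S : {set V}) :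
  chromatic_number (induced G S) <= clique_number (induced G S) ^ (4 ^ m).
Proof.
pose R p : rel {x | x \in S} := fun x y => pattern_order p (val x) (val y).
have -> : 4 ^ m = #|{ffun 'I_m -> bool * bool}|.
  by rewrite card_ffun card_prod card_bool card_ord.
apply: (chromatic_number_cover _ _ _ R) => [p y x z|p x y|x y].
- exact: pattern_order_trans.
- exact: pattern_order_sub.
- exact: pattern_order_cover.
Qed.

End OrderCover.

Theorem theorem5p11 (Y : graph_class) :
  class_function_of Y permutation_graphs -> polynomially_chi_bounded Y.
Proof.
case=> k Yk; exists ('X^(4 ^ k))%R => V G YG S.
have [m [H [le_mk permH [f GE]]]] := Yk V G YG.
have [L L_trans LE] := fin_all_exists2 (fun i =>
  permutation_graph_orders V (H i) (permH i)).
have chi_le := chromatic_number_induced_le V G m H f L GE L_trans LE S.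
rewrite hornerXn -!natz -GRing.natrX !natz lez_nat.
apply: leq_trans chi_le _.
(* Powers grow with the exponent only for a positive base; at base 0 both powers vanish, their
   exponents being positive. *)
have [->|omega_gt0] := posnP (clique_number (induced G S)).
  by rewrite !exp0n ?expn_gt0.
by rewrite leq_pexp2l // leq_pexp2l.
Qed.
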